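(* Let $x, y, z$ be positive integers with $z>x>y$, and let $n$ be a positive integer that is the reversion exponent of $\{y,x,z\}$, i.e. $z^{n-1}<x^{n-1}+y^{n-1}$ and $z^{n}>x^{n}+y^{n}$. Then $$0<n-\frac{\log(x^n+y^n)}{\log z}<1 .$$
   Context: For positive integers $x,y,z$, a positive integer $n$ is called the reversion exponent of the triplet $\{y,x,z\}$ when $z^{n-1}<x^{n-1}+y^{n-1}$ and $z^{n}>x^{n}+y^{n}$. Here $\log$ denotes the natural logarithm. *)

(* Defs.v *)
From Stdlib Require Import Reals.

(* The arguments follow the order of the triplet {y, x, z}; since [0 < n], the
   truncated subtraction [n - 1] is the ordinary one. *)
Definition reversion_exponent (y x z n : nat) : Prop :=
  (0 < n /\ z ^ (n - 1) < x ^ (n - 1) + y ^ (n - 1) /\ z ^ n > x ^ n + y ^ n)%nat.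

(* Main.v *)
Require Import Defs.
From Stdlib Require Import Reals Lra Lia.

(** Since [x] and [y] are positive,
    [z ^ (n - 1) < x ^ (n - 1) + y ^ (n - 1) <= x ^ n + y ^ n < z ^ n];
    take logarithms in base [z]. *)

(** The claim amounts to n - 1 < log_z s < n for s = x^n + y^n: the sum is trapped strictly between
    consecutive powers of z, and [log_between_powers] turns this into bounds on the exponent, log_z
    being increasing for z > 1. *)

Lemma log_between_powers (z s : R) (m : nat) :
  (1 < z -> z ^ m < s -> s < z ^ S m -> INR m < ln s / ln z < INR (S m))%R.
Proof.
  intros hz hl hu.
  assert (hz0 : (0 < z)%R) by lra.
  assert (hm : (0 < z ^ m)%R) by now apply pow_lt.
  assert (hlnz : (0 < ln z)%R) by (rewrite <- ln_1; apply ln_increasing; lra).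
  pose proof (ln_increasing _ _ hm hl) as Hl.
  assert (Hu : (ln s < ln (z ^ S m))%R) by (apply ln_increasing; lra).
  rewrite ln_pow in Hl, Hu by assumption.
  split; apply (Rmult_lt_reg_r (ln z)); trivial;
    unfold Rdiv; rewrite Rmult_assoc, Rinv_l, Rmult_1_r; lra.
Qed.

Theorem corollary1 (x y z n : nat)
  (hx : (0 < x)%nat) (hy : (0 < y)%nat) (hz : (0 < z)%nat)
  (hzx : (z > x)%nat) (hxy : (x > y)%nat)
  (hn : reversion_exponent y x z n) :
  (0 < INR n - ln (INR x ^ n + INR y ^ n) / ln (INR z) < 1)%R.
Proof.
  destruct hn as (hn0 & hlow & hupp).
  destruct n as [|m]; [lia|].
  replace (S m - 1)%nat with m in hlow by lia.
  assert (hxm : (x ^ m <= x ^ S m)%nat) by (apply Nat.pow_le_mono_r; lia).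
  assert (hym : (y ^ m <= y ^ S m)%nat) by (apply Nat.pow_le_mono_r; lia).
  (* The argument of [ln] becomes the cast of a natural number, so the inequalities in [nat]
     transfer by [lt_INR]. *)
  rewrite <- !pow_INR, <- plus_INR.
  destruct (log_between_powers (INR z) (INR (x ^ S m + y ^ S m)) m) as [Hl Hu].
  (* [INR 1] computes to the real 1, and z > x > y > 0 forces z > 1. *)
  - apply (lt_INR 1); lia.
  - rewrite <- pow_INR; apply lt_INR; lia.
  - rewrite <- pow_INR; apply lt_INR; lia.
  - rewrite S_INR in *; lra.
Qed.
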